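(* Let $u\in\mathbb{N}^+$, $v\in(0,1]$ and let $\omega:\mathbb{N}^+\times\mathbb{N}\to\mathbb{R}^+$ be a penalty function. For all $i,j\in E$, the Gerber-Shiu function $$\phi_{ij}(u)=\mathbb{E}\left[v^{\tau_0}\,\omega(U_{\tau_0-1},|U_{\tau_0}|)\,\mathbb{I}_{(\tau_0<\infty,\;J_{\tau_0}=j)}\,\middle|\,J_0=i,\,U_0=u\right]$$ can be expressed as $$\phi_{ij}(u)=v\sum_{k=1}^\infty\sum_{m=k}^\infty\sum_{l=1}^N \omega(k,m-k)\,H^{(v)}_{il}(k,\tau_0;u)\,\lambda_{lj}(m).$$
   Context: $\mathbb{N}=\{0,1,2,\dots\}$, $\mathbb{N}^+=\{1,2,\dots\}$, $\mathbb{R}^+=[0,\infty)$, $E=\{1,\dots,N\}$. Risk process: $U_n=u+n-\sum_{i=1}^n Z_i$, where $u=U_0$ is the initial reserve and the claims $Z_k$ are $\mathbb{N}$-valued. The phase process $\{J_n\}_{n\in\mathbb{N}}$ is a homogeneous Markov chain on $E$, irreducible and positive recurrent with stationary distribution $\boldsymbol{\pi}$. Given the past up to time $k-1$ and $J_{k-1}=i$, the pair $(Z_k,J_k)$ has law $$\lambda_{ij}(m)=\mathbb{P}(Z_1=m,J_1=j\mid J_0=i),\qquad m=0,1,2,\dots,$$ with $\mathbb{E}(Z_1\mathbb{I}_{(J_1=j)}\mid J_0=i)<\infty$ for all $i,j\in E$. Writing $(\mathbf{\Lambda}(m))_{ij}=\lambda_{ij}(m)$, the matrix $\mathbf{\Lambda}(0)$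 is assumed non-singular. The net profit condition $\boldsymbol{\pi}^\top\sum_{m\ge0}(m-1)\mathbf{\Lambda}(m)\boldsymbol{e}<0$ is assumed, where $\boldsymbol{e}$ is the column vector of ones. Ruin time: $\tau_0=\inf\{n\in\mathbb{N}:U_n\le0\}$, with $\tau_0=\infty$ if $U_n>0$ for all $n$. $v$-potential function: $$H^{(v)}_{ij}(x,\tau_0;u)=\sum_{n=0}^\infty v^n\,\mathbb{P}\left(U_n=x,\,J_n=j,\,n<\tau_0\mid J_0=i,\,U_0=u\right).$$ Sums of non-negative terms are taken in $[0,\infty]$.
   Formalization: The printed formula is off by one (it omits the premium of the ruin period): the theorem proved sums over m ≥ k+1 with ω(k, m−k−1) in place of m ≥ k with ω(k, m−k). *)

(* Defs.v *)
From HB Require Import structures.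
From mathcomp Require Import all_boot all_order all_algebra.
From mathcomp Require Import all_classical all_reals all_analysis.
Set Implicit Arguments.
Unset Strict Implicit.
Unset Printing Implicit Defensive.
Import Order.TTheory GRing.Theory Num.Theory.
Import numFieldNormedType.Exports.
Local Open Scope classical_set_scope.
Local Open Scope ring_scope.

(* The phase space {1, ..., N} is 'I_N, and lam m : 'M[R]_N is the matrix
   whose (i, j) entry is the probability, from phase i, of a claim m together
   with a move to phase j. *)

Section ClaimKernel.
Variables (R : realType) (N : nat).
Implicit Types (lam A : nat -> 'M[R]_N) (p : 'M[R]_N) (pi : 'rV[R]_N).

Local Open Scope ereal_scope.

Definition claim_kernel lam : Prop :=
  (forall m i j, (0 <= lam m i j)%R) /\
  (forall i, \sum_(0 <= m <oo) (\sum_j lam m i j)%R%:E = 1).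

(* For a claim kernel, the (i, j) sum is E(Z_1 1_(J_1 = j) | J_0 = i). *)
Definition finite_claim_means lam : Prop :=
  forall i j, \sum_(0 <= m <oo) (m%:R * lam m i j)%R%:E < +oo.

Local Close Scope ereal_scope.

Definition mx_series A : 'M[R]_N :=
  \matrix_(i, j) limn (series (fun m => A m i j)).

Definition phase_mx lam : 'M[R]_N := mx_series lam.

Definition drift_mx lam : 'M[R]_N := mx_series (fun m => (m%:R - 1) *: lam m).

Definition stationary_distribution p pi : Prop :=
  [/\ forall i, 0 <= pi 0 i, \sum_i pi 0 i = 1 & pi *m p = pi].

Definition irreducible_chain p : Prop :=
  forall i j, exists n, 0 < (p ^+ n) i j.

(* first_passage p j n i is the probability that the chain with transition
   matrix p, started from i, visits j at time n for the first time since
   time 1. *)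
Fixpoint first_passage p (j : 'I_N) (n : nat) (i : 'I_N) : R :=
  match n with
  | 0 => 0
  | 1 => p i j
  | n'.+1 => \sum_(k | k != j) p i k * first_passage p j n' k
  end.

Definition positive_recurrent p : Prop :=
  forall i,
    (\sum_(0 <= n <oo) (first_passage p i n i)%:E = 1)%E /\
    (\sum_(0 <= n <oo) (n%:R * first_passage p i n i)%:E < +oo)%E.

Definition net_profit lam pi : Prop :=
  (pi *m drift_mx lam *m const_mx 1 : 'M[R]_1) 0 0 < 0.

End ClaimKernel.

Section Conditioning.
Context {d : measure_display} {T : measurableType d} {R : realType}.
Variable P : probability T R.
Implicit Types (A B : set T) (X : T -> \bar R).

Local Open Scope ereal_scope.

(* Both are 0 when P B = 0. *)
Definition cond_prob A B : \bar R := P (A `&` B) * ((fine (P B))^-1)%:E.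

Definition cond_expectation X B : \bar R :=
  (\int[P]_(w in B) X w) * ((fine (P B))^-1)%:E.

End Conditioning.

Section RiskProcess.
Context {d : measure_display} {T : measurableType d} {R : realType}.
Variables (P : probability T R) (N : nat).
(* Claims are Z 1, Z 2, ...; the variable Z 0 plays no role. *)
Variables (J : nat -> T -> 'I_N) (Z : nat -> T -> nat).

Definition past (z : nat -> nat) (s : nat -> 'I_N) (n : nat) : set T :=
  [set w | J 0%N w = s 0%N /\
     forall k, (1 <= k <= n)%N -> Z k w = z k /\ J k w = s k].

Definition markov_claims (lam : nat -> 'M[R]_N) : Prop :=
  [/\ forall n j, measurable [set w | J n w = j],
      forall n, (0 < n)%N -> measurable_fun setT (Z n)
    & forall z s n m j, P (past z s n) != 0%E ->
        cond_prob P [set w | Z n.+1 w = m /\ J n.+1 w = j] (past z s n)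
        = (lam m (s n) j)%:E].

(* U_(n+1) = U_n + 1 - Z_(n+1): the premium is counted in the ruin step, so
   from level k a claim m ruins exactly when m > k, with deficit m - k - 1. *)
Definition reserve (u n : nat) (w : T) : int :=
  u%:Z + n%:Z - \sum_(1 <= k < n.+1) (Z k w)%:Z.

(* None stands for an infinite ruin time. *)
Definition ruin_time (u : nat) (w : T) : option nat :=
  match pselect (exists n, reserve u n w <= 0) with
  | left ex_ruin => Some (ex_minn ex_ruin)
  | right _ => None
  end.

Definition before (n : nat) (t : option nat) : Prop :=
  match t with
  | Some t' => (n < t')%N
  | None => True
  end.

Definition potential (v : R) (i j : 'I_N) (x : int) (u : nat) : \bar R :=
  (\sum_(0 <= n <oo) (v ^+ n)%:E *
     cond_prob P
       [set w | [/\ reserve u n w = x, J n w = j & before n (ruin_time u w)]]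
       [set w | J 0%N w = i])%E.

Definition discounted_penalty (v : R) (omega : nat -> nat -> R) (j : 'I_N)
    (u : nat) (w : T) : R :=
  match ruin_time u w with
  | Some t =>
      if J t w == j
      then v ^+ t * omega `|reserve u t.-1 w|%N `|reserve u t w|%N
      else 0
  | None => 0
  end.

Definition gerber_shiu (v : R) (omega : nat -> nat -> R) (i j : 'I_N)
    (u : nat) : \bar R :=
  cond_expectation P (fun w => (discounted_penalty v omega j u w)%:E)
    [set w | J 0%N w = i].

End RiskProcess.

(* Main.v *)
Require Import Defs.
From HB Require Import structures.
From mathcomp Require Import all_boot all_order all_algebra.
From mathcomp Require Import all_classical all_reals all_analysis.
From mathcomp Require Import measurable_realfun zify.
Import Order.TTheory GRing.Theory Num.Theory.
Import numFieldNormedType.Exports.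
Set Implicit Arguments.
Unset Strict Implicit.
Unset Printing Implicit Defensive.
Local Open Scope classical_set_scope.
Local Open Scope ring_scope.

(** Ruin is a single jump: it happens at time n.+1 exactly when the process is
    alive at time n at some level k > 0 and the next claim m exceeds k.  These
    n, k and m are determined by the path, and so is the phase l = J_n, hence
    among all events [alive at n, U_n = k, J_n = l, Z_(n+1) = m, J_(n+1) = j]
    with m > k at most one contains a given path, and one does precisely when
    ruin occurs in phase j.  The discounted penalty is therefore, path by path,
    the quadruple series over k, m, l, n of
      v ^+ n.+1 * omega k (m - k.+1)
    times the indicator of that event ([discounted_penalty_series]).

    All terms being nonnegative, conditional expectation given J_0 = i goes
    through the series (the [nonneg_cond_mean] closure lemmas), and no exchange
    of summations is needed, as the series over n is already the innermost one,
    just as in the potential.  What remains is that each event has conditional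
    probability P(U_n = k, J_n = l, n < tau | J_0 = i) * lam m l j.  The
    defining property of the claim process gives this for one complete history
    up to n; there are countably many histories, and an event that depends on
    the history only is a disjoint union of them ([next_step_past_event]). *)

(** * Series *)

(** The partial sums beyond k are all equal to f k, whatever its sign. *)
Lemma eseries_single (R : realType) (f : nat -> \bar R) (N k : nat) :
  (N <= k)%N -> (forall n, (N <= n)%N -> n != k -> f n = 0%E) ->
  (\sum_(N <= n <oo) f n = f k)%E.
Proof.
move=> Nk f0; apply: lim_near_cst => //.
near=> n.
have kn : (k < n)%N by near: n; exact: nbhs_infty_gt.
rewrite (bigD1_seq k) ?mem_index_iota ?Nk ?kn ?iota_uniq //=.
rewrite big_nat_cond big1 ?adde0// => i /andP[/andP[Ni _]].
exact: f0.
Unshelve. all: by end_near.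
Qed.

Lemma eseries_from (R : realType) (f : nat -> \bar R) (N : nat) :
  (\sum_(N <= n <oo) f n = \sum_(n <oo) if (N <= n)%N then f n else 0)%E.
Proof. by rewrite eseries_cond eseries_mkcond. Qed.

(** * Conditional means of nonnegative functions *)

Section ConditionalMeans.
Context {d : measure_display} {T : measurableType d} {R : realType}.
Variables (P : probability T R) (B : set T).
Hypothesis mB : measurable B.
Implicit Types (X : T -> \bar R) (A : set T).

Local Open Scope ereal_scope.

(** Measurability, sign and value travel together, so that the mean of a nested
    series is read off its shape, one closure lemma for each operation. *)
Definition nonneg_cond_mean X (a : \bar R) : Prop :=
  [/\ measurable_fun B X, forall w, B w -> 0 <= X w
    & cond_expectation P X B = a].

Lemma nonneg_cond_mean0 : nonneg_cond_mean (fun=> 0) 0.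
Proof. by split=> //; rewrite /cond_expectation integral0 mul0e. Qed.

Lemma nonneg_cond_meanZ (r : R) X a : (0 <= r)%R ->
  nonneg_cond_mean X a -> nonneg_cond_mean (fun w => r%:E * X w) (r%:E * a).
Proof.
move=> r0 [mX X0 <-]; split; first exact: measurable_funeM.
  by move=> w Bw; rewrite mule_ge0 ?X0 ?lee_fin.
by rewrite /cond_expectation ge0_integralZl// muleA.
Qed.

Lemma nonneg_cond_mean_sum (I : finType) (X : I -> T -> \bar R) (a : I -> \bar R) :
  (forall i, nonneg_cond_mean (X i) (a i)) ->
  nonneg_cond_mean (fun w => \sum_i X i w) (\sum_i a i).
Proof.
move=> HX; split.
- by apply: emeasurable_sum => i; case: (HX i).
- by move=> w Bw; apply: sume_ge0 => i _; case: (HX i) => _ + _; exact.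
- rewrite /cond_expectation ge0_integral_sum//; last 2 first.
  + by move=> i; case: (HX i).
  + by move=> i w Bw; case: (HX i) => _ + _; exact.
  rewrite ge0_sume_distrl => [|i _]; last first.
    by apply: integral_ge0 => w Bw; case: (HX i) => _ + _; exact.
  by apply: eq_bigr => i _; case: (HX i).
Qed.

Lemma nonneg_cond_mean_series (N : nat) (X : nat -> T -> \bar R) (a : nat -> \bar R) :
  (forall n, (N <= n)%N -> nonneg_cond_mean (X n) (a n)) ->
  nonneg_cond_mean (fun w => \sum_(N <= n <oo) X n w) (\sum_(N <= n <oo) a n).
Proof.
move=> HX.
(* Monotone convergence and measurability apply to series from 0, and X n may
   be negative below N; hence the terms cut off there. *)
pose Y n w := if (N <= n)%N then X n w else 0.
have HY n : nonneg_cond_mean (Y n) (if (N <= n)%N then a n else 0).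
  rewrite /Y; case: ifP => [Nn|_]; [exact: HX|exact: nonneg_cond_mean0].
have mY n : measurable_fun B (Y n) by case: (HY n).
have Y0 n w : B w -> 0 <= Y n w by case: (HY n) => _ + _; exact.
under eq_fun do rewrite eseries_from.
rewrite eseries_from; split.
- apply: (ge0_emeasurable_sum (h := Y) (P := xpredT)) => //.
  by move=> k w Bw _; exact: Y0.
- by move=> w Bw; apply: nneseries_ge0 => n _ _; exact: Y0.
- rewrite /cond_expectation integral_nneseries// muleC -nneseriesZl; last first.
    by move=> n _; apply: integral_ge0 => w; exact: Y0.
  by apply: eq_eseriesr => n _; rewrite muleC; case: (HY n).
Qed.

Lemma nonneg_cond_mean_indic A : measurable A ->
  nonneg_cond_mean (fun w => (\1_A w)%:E) (cond_prob P A B).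
Proof.
move=> mA; split.
- by apply/measurable_EFinP; exact: measurable_indic.
- by move=> w _; rewrite lee_fin.
- by rewrite /cond_expectation integral_indic.
Qed.

End ConditionalMeans.

(** * The reserve and the ruin time *)

Section Reserve.
Context {d : measure_display} {T : measurableType d}.
Variables (Z : nat -> T -> nat) (u : nat).
Implicit Types (n t k m : nat) (w : T).

Lemma reserve0 w : reserve Z u 0 w = u%:Z.
Proof. by rewrite /reserve big_geq// subr0 addr0. Qed.

Lemma reserveS n w :
  reserve Z u n.+1 w = reserve Z u n w + 1 - (Z n.+1 w)%:Z.
Proof.
rewrite /reserve big_nat_recr//=; set S := \sum_(_ <= _ < _) _.
lia.
Qed.

Lemma ruin_timeP t w :
  ruin_time Z u w = Some t <->
  reserve Z u t w <= 0 /\ forall s, (s < t)%N -> 0 < reserve Z u s w.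
Proof.
rewrite /ruin_time; case: pselect => [ex_ruin|no_ruin]; last first.
  by split=> // -[ruined _]; case: no_ruin; exists t.
case: ex_minnP => t' ruined' min_t'; split=> [[<-]|[ruined pos]].
  split=> // s st'; rewrite ltNge; apply/negP => /min_t'.
  by rewrite leqNgt st'.
congr Some; apply/eqP; rewrite eqn_leq min_t'// leqNgt; apply/negP => /pos.
by rewrite ltNge ruined'.
Qed.

Lemma before_ruinP n w :
  before n (ruin_time Z u w) <->
  forall s, (s <= n)%N -> 0 < reserve Z u s w.
Proof.
case E : (ruin_time Z u w) => [t|] /=.
  have [ruined pos] := (ruin_timeP _ _).1 E.
  split=> [nt s sn|pos_n]; first by apply: pos; exact: leq_ltn_trans nt.
  by rewrite ltnNge; apply/negP => /pos_n; rewrite ltNge ruined.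
split=> // _ s _; rewrite ltNge; apply/negP => ruined.
by move: E; rewrite /ruin_time; case: pselect => // no_ruin; case: no_ruin; exists s.
Qed.

(** The reserve moves from k to k + 1 - m, which is at most 0 as soon as k < m. *)
Lemma ruin_at_step n k w : reserve Z u n w = k%:Z -> (k < Z n.+1 w)%N ->
  before n (ruin_time Z u w) -> ruin_time Z u w = Some n.+1.
Proof.
move=> Uk kZ /before_ruinP pos; apply/ruin_timeP; split; last first.
  by move=> s; rewrite ltnS; exact: pos.
by rewrite reserveS Uk; lia.
Qed.

(** Up to time n the reserve is positive, so absolute values lose nothing there
    and the level before ruin is a positive natural number; from that level k,
    a claim m leaves the deficit m - k - 1. *)
Lemma before_ruin_step n w : ruin_time Z u w = Some n.+1 ->
  [/\ before n (ruin_time Z u w), (0 < `|reserve Z u n w|)%N,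
      reserve Z u n w = `|reserve Z u n w|%N%:Z,
      (`|reserve Z u n w| < Z n.+1 w)%N
    & `|reserve Z u n.+1 w|%N = (Z n.+1 w - `|reserve Z u n w|.+1)%N].
Proof.
move=> E; rewrite E /=; have [ruined pos] := (ruin_timeP _ _).1 E.
have := pos n (ltnSn n); move: ruined; rewrite reserveS => ruined Un.
by split=> //; lia.
Qed.

End Reserve.

(** * Events determined by the past *)

Section History.
Context {d : measure_display} {T : measurableType d} {R : realType}.
Variables (P : probability T R) (N : nat).
Variables (J : nat -> T -> 'I_N) (Z : nat -> T -> nat) (lam : nat -> 'M[R]_N).
Hypothesis JZ_markov : markov_claims P J Z lam.
Implicit Types (A F : set T) (n m : nat) (w : T).

Definition same_past n w : set T := past J Z (Z^~ w) (J^~ w) n.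

(** Only finitely many coordinates enter a history, so that it is coded by a
    natural number; conditioning on the whole sequences would not give a
    countable partition. *)
Definition past_code n w : nat :=
  pickle ([seq Z k w | k <- iota 1 n], [seq J k w | k <- iota 0 n.+1]).

Lemma past_codeP n w w' : past_code n w' = past_code n w <-> same_past n w w'.
Proof.
split=> [/(pcan_inj pickleK)[]|[J0 ZJ]].
  move=> /eq_in_map eqZ J0 /eq_in_map eqJ; split=> // k kn; split.
    by apply: eqZ; rewrite mem_iota; lia.
  by apply: eqJ; rewrite mem_iota; lia.
congr pickle; congr pair; apply/eq_in_map => k; rewrite mem_iota => kn.
  by apply: (ZJ k _).1; lia.
by case: k kn => [//|k] kn; apply: (ZJ k.+1 _).2; lia.
Qed.

Lemma measurable_phase n j : measurable [set w | J n w = j].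
Proof. by case: JZ_markov => + _ _; exact. Qed.

Lemma measurable_claim n m : measurable [set w | Z n.+1 w = m].
Proof.
case: JZ_markov => _ mZ _; rewrite -[X in measurable X]setTI.
exact: (mZ n.+1 isT measurableT [set m]).
Qed.

Lemma measurable_past z s n : measurable (past J Z z s n).
Proof.
have -> : past J Z z s n = [set w | J 0%N w = s 0%N] `&`
    \bigcap_(k in [set k | (k < n)%N])
      ([set w | Z k.+1 w = z k.+1] `&` [set w | J k.+1 w = s k.+1]).
  apply/seteqP; split=> w [J0 ZJ]; split=> //.
    by move=> k /= kn; apply: ZJ.
  by case=> [//|k] kn; apply: ZJ.
apply: measurableI; first exact: measurable_phase.
apply: bigcap_measurableType => // k _.
by apply: measurableI; [exact: measurable_claim|exact: measurable_phase].
Qed.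

Definition past_event n A : Prop :=
  forall w w', same_past n w w' -> A w -> A w'.

(** A history either implies a past event or excludes it; this is what lets a
    property of single histories pass to past events. *)
Lemma past_event_fiber n A c : past_event n A ->
  A `&` [set w | past_code n w = c] = set0 \/
  exists2 w, A w & A `&` [set w | past_code n w = c] = same_past n w.
Proof.
move=> pA; have [->|/set0P[w [Aw wc]]] := eqVneq (A `&` [set w | past_code n w = c]) set0.
  by left.
right; exists w => //; apply/seteqP; split=> w' /=.
  by move=> [_ w'c]; apply/past_codeP; rewrite w'c.
by move=> sp; split; [exact: pA sp Aw|rewrite -wc; apply/past_codeP].
Qed.

Lemma past_event_bigcup n A :
  A = \bigcup_c (A `&` [set w | past_code n w = c]).
Proof.
rewrite -setI_bigcupr; apply/seteqP; split=> [w Aw|w []//].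
by split=> //; exists (past_code n w).
Qed.

Lemma measurable_past_event_fiber n A c : past_event n A ->
  measurable (A `&` [set w | past_code n w = c]).
Proof. by move=> /past_event_fiber => /(_ c)[->//|[w _ ->]]; exact: measurable_past. Qed.

Lemma measurable_past_event n A : past_event n A -> measurable A.
Proof.
move=> pA; rewrite (past_event_bigcup n A).
by apply: bigcup_measurable => c _; exact: measurable_past_event_fiber.
Qed.

Local Open Scope ereal_scope.

Lemma past_event_split n A F : past_event n A -> measurable F ->
  P (A `&` F) = \sum_(c <oo) P (A `&` [set w | past_code n w = c] `&` F).
Proof.
move=> pA mF; rewrite {1}(past_event_bigcup n A) setI_bigcupl measure_semi_bigcup//.
- by move=> c; apply: measurableI => //; exact: measurable_past_event_fiber.
- by move=> c c' _ _ [w [[[_ <-] _] [[_ <-] _]]].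
- apply: bigcup_measurable => c _; apply: measurableI => //.
  exact: measurable_past_event_fiber.
Qed.

Definition next_step n m j : set T := [set w | Z n.+1 w = m /\ J n.+1 w = j].

Lemma measurable_next_step n m j : measurable (next_step n m j).
Proof. by apply: measurableI; [exact: measurable_claim|exact: measurable_phase]. Qed.

(** For a history of positive probability this is the defining property of the
    claim process, with the conditional probability cleared of its denominator;
    for a null history both sides are 0. *)
Lemma next_step_same_past n m j w :
  P (same_past n w `&` next_step n m j) =
  P (same_past n w) * (lam m (J n w) j)%:E.
Proof.
have mS : measurable (same_past n w) := measurable_past _ _ _.
have mF := measurable_next_step n m j.
have [P0|P0] := eqVneq (P (same_past n w)) 0.
  rewrite P0 mul0e; apply: subset_measure0 P0 => //.
  exact: measurableI.
case: JZ_markov => _ _ /(_ _ _ _ m j P0) <-.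
rewrite /cond_prob -/(same_past n w) muleCA setIC.
have Pfin : P (same_past n w) \is a fin_num by exact: fin_num_measure.
have -> : P (same_past n w) * ((fine (P (same_past n w)))^-1)%:E = 1.
  by rewrite -[X in X * _]fineK// -EFinM mulfV// fine_eq0.
by rewrite mule1.
Qed.

(** The Markov property for past events: sum the product formula over the
    histories that make up A.  They may differ in everything but the last phase
    l, the only part of the history on which the transition depends. *)
Lemma next_step_past_event n A l m j : past_event n A ->
  (forall w, A w -> J n w = l) ->
  P (A `&` next_step n m j) = P A * (lam m l j)%:E.
Proof.
move=> pA Al; have mF := measurable_next_step n m j.
rewrite (past_event_split pA mF) -[in RHS](setIT A) (past_event_split pA measurableT).
rewrite muleC -nneseriesZl//; apply: eq_eseriesr => c _; rewrite setIT.
have [->|[w Aw ->]] := past_event_fiber c pA; first by rewrite set0I measure0 mule0.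
by rewrite next_step_same_past (Al w Aw) muleC.
Qed.

Lemma reserve_same_past (u n t : nat) w w' : same_past n w w' -> (t <= n)%N ->
  reserve Z u t w' = reserve Z u t w.
Proof.
move=> [_ ZJ] tn; rewrite /reserve; congr (_ - _)%R.
by apply: eq_big_nat => k kt; rewrite (ZJ k _).1//; lia.
Qed.

Definition alive (u n k : nat) (l : 'I_N) : set T :=
  [set w | [/\ reserve Z u n w = k%:Z, J n w = l & before n (ruin_time Z u w)]].

Lemma past_event_alive (u n k : nat) (l : 'I_N) : past_event n (alive u n k l).
Proof.
move=> w w' sp [Uk Jl /before_ruinP pos]; split.
- by rewrite (reserve_same_past u sp).
- case: n sp Jl {Uk pos} => [[J0 _] <-//|n [_ ZJ] <-].
  by apply: (ZJ n.+1 _).2; rewrite leqnn.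
- by apply/before_ruinP => s sn; rewrite (reserve_same_past u sp)// pos.
Qed.

Lemma past_event_phase0 n i : past_event n [set w | J 0%N w = i].
Proof. by move=> w w' [J0 _] /= <-. Qed.

End History.

(** * Decomposition of the penalty at the ruin step *)

Section RuinDecomposition.
Context {d : measure_display} {T : measurableType d} {R : realType}.
Variables (N : nat) (J : nat -> T -> 'I_N) (Z : nat -> T -> nat).
Variables (v : R) (omega : nat -> nat -> R) (j : 'I_N) (u : nat).

Definition ruin_step n k m l : set T := alive J Z u n k l `&` next_step J Z n m j.

Lemma ruin_step_ruin n k m l w : (k < m)%N -> ruin_step n k m l w ->
  ruin_time Z u w = Some n.+1.
Proof.
move=> km [[Uk _ alive_n] [Zm _]].
by apply: (ruin_at_step Uk) alive_n; rewrite Zm.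
Qed.

Local Open Scope ereal_scope.

(** Each of the four sums has at most one nonzero term: the level, claim, phase
    and time of the ruin step of the path w.  Since u > 0, ruin is not at time 0
    and there is a step before it. *)
Lemma discounted_penalty_series w : (0 < u)%N ->
  (discounted_penalty J Z v omega j u w)%:E =
  v%:E * \sum_(1 <= k <oo) \sum_(k.+1 <= m <oo) \sum_(l < N)
    (omega k (m - k.+1)%N)%:E *
      \sum_(n <oo) (v ^+ n)%:E * (\1_(ruin_step n k m l) w)%:E.
Proof.
move=> u_gt0.
have zero k m l : (forall n, ~ ruin_step n k m l w) ->
    (omega k (m - k.+1)%N)%:E *
      \sum_(n <oo) (v ^+ n)%:E * (\1_(ruin_step n k m l) w)%:E = 0.
  move=> noruin; rewrite eseries0 ?mule0// => n _ _.
  by rewrite indicE memNset ?mule0//.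
(* Without ruin in phase j, no ruin step occurs, so both sides vanish. *)
have [[t [Et Jt]]|noruin] :=
    pselect (exists t, ruin_time Z u w = Some t /\ J t w = j); last first.
  have -> : discounted_penalty J Z v omega j u w = 0%R.
    rewrite /discounted_penalty; case E : (ruin_time Z u w) => [t|//].
    by case: eqP => // Jt; case: noruin; exists t.
  rewrite eseries0 ?mule0// => k _ _; rewrite eseries0// => m km _.
  rewrite big1// => l _; apply: zero => n step; apply: noruin; exists n.+1.
  by split; [exact: ruin_step_ruin step|case: step => _ []].
rewrite /discounted_penalty Et Jt eqxx.
case: t Et Jt => [/ruin_timeP[]|n Et Jt]; first by rewrite reserve0; lia.
have [bef k_gt0 Uk kZ deficit] := before_ruin_step Et.
set k := `|reserve Z u n w|%N in k_gt0 Uk kZ deficit *.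
(* A ruin step fixes the ruin time, which fixes n, hence k, m and l. *)
have inv n' k' m' l' : (k' < m')%N -> ruin_step n' k' m' l' w ->
    [/\ n' = n, k' = k, m' = Z n.+1 w & l' = J n w].
  move=> km' step; have := ruin_step_ruin km' step; rewrite Et => -[nn'].
  move: step; rewrite /ruin_step -nn' => -[[Uk' <- _] [<- _]]; split=> //.
  by rewrite /k Uk'.
rewrite deficit (@eseries_single _ _ _ k)//; last first.
  move=> k' _ /eqP kk'; apply: eseries0 => m' km' _; apply: big1 => l' _.
  by apply: zero => n' /(inv _ _ _ _ km')[].
rewrite (@eseries_single _ _ _ (Z n.+1 w))//; last first.
  move=> m' km' /eqP mm'; apply: big1 => l' _.
  by apply: zero => n' /(inv _ _ _ _ km')[].
rewrite (bigD1 (J n w))//= big1 ?adde0; last first.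
  by move=> l' /eqP ll'; apply: zero => n' /(inv _ _ _ _ kZ)[].
rewrite (@eseries_single _ _ _ n)//; last first.
  move=> n' _ /eqP nn'; rewrite indicE memNset ?mule0//.
  by move=> /(inv _ _ _ _ kZ)[].
rewrite indicE mem_set ?mule1; last by split.
by rewrite -!EFinM exprS -mulrA (mulrC (v ^+ n)%R).
Qed.

End RuinDecomposition.

(** * The probability of a ruin step *)

Section StepProbability.
Context {d : measure_display} {T : measurableType d} {R : realType}.
Variables (P : probability T R) (N : nat).
Variables (J : nat -> T -> 'I_N) (Z : nat -> T -> nat) (lam : nat -> 'M[R]_N).
Hypothesis JZ_markov : markov_claims P J Z lam.
Variables (i j : 'I_N) (u : nat).

Local Open Scope ereal_scope.

Lemma measurable_ruin_step n k m l : measurable (ruin_step J Z j u n k m l).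
Proof.
apply: measurableI; last exact: (measurable_next_step JZ_markov).
exact: (measurable_past_event JZ_markov (@past_event_alive _ _ _ J Z u n k l)).
Qed.

Lemma cond_prob_ruin_step n k m l :
  cond_prob P (ruin_step J Z j u n k m l) [set w | J 0%N w = i] =
  cond_prob P (alive J Z u n k l) [set w | J 0%N w = i] * (lam m l j)%:E.
Proof.
rewrite /cond_prob /ruin_step setIAC.
rewrite (@next_step_past_event _ _ _ _ _ _ _ _ JZ_markov _ _ l).
- by rewrite muleAC.
- move=> w w' sp [Aw Bw]; split; first exact: past_event_alive sp Aw.
  exact: past_event_phase0 sp Bw.
- by move=> w [[_ -> _]].
Qed.

End StepProbability.

(** * The Gerber-Shiu function *)

Theorem proposition3 (d : measure_display) (T : measurableType d)
    (R : realType) (P : probability T R) (N : nat)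
    (J : nat -> T -> 'I_N) (Z : nat -> T -> nat)
    (lam : nat -> 'M[R]_N) (pi : 'rV[R]_N)
    (lam_kernel : claim_kernel lam)
    (lam_means : finite_claim_means lam)
    (JZ_markov : markov_claims P J Z lam)
    (J_irreducible : irreducible_chain (phase_mx lam))
    (J_recurrent : positive_recurrent (phase_mx lam))
    (pi_stationary : stationary_distribution (phase_mx lam) pi)
    (lam0_unit : lam 0%N \in unitmx)
    (lam_profit : net_profit lam pi)
    (u : nat) (u_gt0 : (0 < u)%N)
    (v : R) (v_gt0 : 0 < v) (v_le1 : v <= 1)
    (omega : nat -> nat -> R)
    (omega_ge0 : forall k r, (0 < k)%N -> 0 <= omega k r)
    (i j : 'I_N) :
  (gerber_shiu P J Z v omega i j u =
   v%:E * \sum_(1 <= k <oo) \sum_(k.+1 <= m <oo) \sum_(l < N)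
     (omega k (m - k.+1)%N)%:E * potential P J Z v i l k%:Z u
       * (lam m l j)%:E)%E.
Proof.
have mB := measurable_phase JZ_markov 0 i.
rewrite /gerber_shiu.
under eq_fun do rewrite (discounted_penalty_series _ _ _ _ _ _ u_gt0).
suff : nonneg_cond_mean P [set w | J 0%N w = i] (fun w =>
    v%:E * \sum_(1 <= k <oo) \sum_(k.+1 <= m <oo) \sum_(l < N)
      (omega k (m - k.+1)%N)%:E *
      \sum_(n <oo) (v ^+ n)%:E * (\1_(ruin_step J Z j u n k m l) w)%:E)%E
    (v%:E * \sum_(1 <= k <oo) \sum_(k.+1 <= m <oo) \sum_(l < N)
       (omega k (m - k.+1)%N)%:E * potential P J Z v i l k%:Z u
         * (lam m l j)%:E)%E by case.
apply: (nonneg_cond_meanZ mB); first exact: ltW.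
apply: (nonneg_cond_mean_series mB) => k k_gt0.
apply: (nonneg_cond_mean_series mB) => m _.
apply: (nonneg_cond_mean_sum mB) => l.
(* The transition probability to j enters the series over n, where it turns
   the terms of the potential into probabilities of ruin steps. *)
have -> : ((omega k (m - k.+1)%N)%:E * potential P J Z v i l k%:Z u * (lam m l j)%:E =
    (omega k (m - k.+1)%N)%:E * \sum_(n <oo) (v ^+ n)%:E *
      cond_prob P (ruin_step J Z j u n k m l) [set w | J 0%N w = i])%E.
  rewrite -muleA; congr (_ * _)%E; rewrite muleC /potential -nneseriesZl.
    apply: eq_eseriesr => n _.
    by rewrite (cond_prob_ruin_step JZ_markov) muleCA (muleC (lam m l j)%:E).
  move=> n _; apply: mule_ge0; first by rewrite lee_fin exprn_ge0 ?ltW.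
  by apply: mule_ge0; rewrite ?lee_fin ?invr_ge0 ?fine_ge0.
apply: (nonneg_cond_meanZ mB); first exact: omega_ge0.
apply: (nonneg_cond_mean_series mB) => n _.
apply: (nonneg_cond_meanZ mB); first by rewrite exprn_ge0 ?ltW.
by apply: nonneg_cond_mean_indic => //; exact: (measurable_ruin_step JZ_markov).
Qed.
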